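(* Let $G$ be a (discrete) Hamiltonian group, let $\phi : G\to G$ be an endomorphism, let $H$ be a subgroup of $G$ with $\phi(H)\leq H$, and let $\bar\phi : G/H\to G/H$ be the induced map. Then $$h_{alg}(\phi)=h_{alg}(\phi\restriction_H)+h_{alg}(\bar\phi).$$
   Context: A non-abelian group $G$ is Hamiltonian if every subgroup of $G$ is normal (so in the statement $H$ is automatically normal). Algebraic entropy of a discrete group (the discrete case, with counting measure, of the general definition for locally compact groups): for an endomorphism $\phi$ of $G$, $U\subseteq G$ and $n\geq 1$ put $T_n(\phi,U)=U\cdot\phi(U)\cdots\phi^{n-1}(U)$. For a finite subset $U$ of $G$ containing $e_G$ put $H_{alg}(\phi,U)=\limsup_{n\to\infty}\frac{\log|T_n(\phi,U)|}{n}$, and let $h_{alg}(\phi)\in[0,\infty]$ be the supremum of $H_{alg}(\phi,U)$ over all such $U$. The entropies of $\phi\restriction_H: H\to H$ and $\bar\phi: G/H\to G/H$, $\bar\phi(gH)=\phi(g)H$, are computed in $H$ and $G/H$. *)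

(* Defs.v *)
From HB Require Import structures.
From mathcomp Require Import all_boot all_order all_algebra.
From mathcomp Require Import finmap.
From mathcomp Require Import all_classical all_reals all_analysis.

Set Implicit Arguments.
Unset Strict Implicit.
Unset Printing Implicit Defensive.

Local Open Scope group_scope.
Local Open Scope quotient_scope.

(* A [groupType] may be infinite. A subgroup is a boolean predicate with a      *)
(* [groupClosed] structure; classically, every subset has such a predicate.    *)

Definition normal_subgroup (G : groupType) (H : {pred G}) : Prop :=
  forall x g : G, x \in H -> x ^ g \in H.

Definition hamiltonian (G : groupType) : Prop :=
  ~ (forall x y : G, x * y = y * x) /\ forall H : groupClosed G, normal_subgroup H.

Definition hamiltonian_normal (G : groupType) (hamG : hamiltonian G)
    (H : groupClosed G) : normal_subgroup H := proj2 hamG H.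
Arguments hamiltonian_normal {G} hamG H.

Section Subgroup.
Variables (G : groupType) (H : groupClosed G).

Definition subgroup_of : Type := {x : G | x \in H}.

HB.instance Definition _ := SubChoice.on subgroup_of.

Fact subgroup_closed : group_closed H.
Proof. by split; [exact: gpred1 | exact: gpredF]. Qed.

HB.instance Definition _ :=
  SubChoice_isSubGroup.Build G _ subgroup_of subgroup_closed.

Variable (phi : {multiplicative G -> G}).
Hypothesis phiH : forall x, x \in H -> phi x \in H.

Definition restr_endo (u : subgroup_of) : subgroup_of :=
  exist _ (phi (val u)) (phiH (valP u)).

Fact restr_endoM : {morph restr_endo : u v / u * v}.
Proof. by move=> u v; apply: val_inj; rewrite /= -gmulfM. Qed.

HB.instance Definition _ :=
  isMultiplicative.Build subgroup_of subgroup_of restr_endo restr_endoM.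

End Subgroup.

Section Quotient.
Variables (G : groupType) (H : groupClosed G).

(* x^-1 y lies in H if and only if xH = yH. *)
Definition coset_rel (x y : G) : bool := x^-1 * y \in H.

Fact coset_rel_equiv : equiv_class_of coset_rel.
Proof.
split=> [x|x y|y x z]; rewrite /coset_rel ?mulVg ?gpred1 //.
  by rewrite -gpredV invgM invgK.
by move=> xy yz; rewrite -(mulgK y (x^-1)) -mulgA gpredM.
Qed.

Canonical coset_equiv := EquivRelPack coset_rel_equiv.
Canonical coset_encModRel := defaultEncModRel coset_rel.

Variable nH : normal_subgroup H.

Definition quotient_of of normal_subgroup H : Type := {eq_quot coset_rel}.
Local Notation Q := (quotient_of nH).

HB.instance Definition _ : EqQuotient G coset_rel Q := EqQuotient.on Q.
HB.instance Definition _ := Choice.on Q.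

Definition quot_one : Q := lift_cst Q 1.
Definition quot_mul : Q -> Q -> Q := lift_op2 Q *%g.
Definition quot_inv : Q -> Q := lift_op1 Q (@monoid.inv G).

Lemma quot_eqP x y : reflect (\pi_Q x = \pi_Q y) (x^-1 * y \in H).
Proof. by apply: (iffP idP) => [h|/eqmodP //]; apply/eqmodP. Qed.

Lemma quot_mulE : {morph \pi_Q : x y / x * y >-> quot_mul x y}.
Proof.
unlock quot_mul => x y; apply/quot_eqP.
have xH : x^-1 * repr (\pi_Q x) \in H by apply/quot_eqP; rewrite reprK.
have yH : y^-1 * repr (\pi_Q y) \in H by apply/quot_eqP; rewrite reprK.
have := gpredM _ _ (nH y xH) yH.
by rewrite /conjg invgM !mulgA mulgK.
Qed.

Lemma quot_invE : {morph \pi_Q : x / x^-1 >-> quot_inv x}.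
Proof.
unlock quot_inv => x; apply/quot_eqP.
have xH : x^-1 * repr (\pi_Q x) \in H by apply/quot_eqP; rewrite reprK.
have := gpredVr _ (nH (x^-1) xH).
by rewrite /conjg !invgM !invgK !mulgA mulgK.
Qed.

Lemma quot_oneE : \pi_Q 1 = quot_one.
Proof. by rewrite /quot_one; unlock. Qed.

Fact quot_mulA : associative quot_mul.
Proof.
by move=> x y z; rewrite -[x]reprK -[y]reprK -[z]reprK -!quot_mulE mulgA.
Qed.

Fact quot_mul1 : left_id quot_one quot_mul.
Proof. by move=> x; rewrite -[x]reprK -quot_oneE -quot_mulE mul1g. Qed.

Fact quot_1mul : right_id quot_one quot_mul.
Proof. by move=> x; rewrite -[x]reprK -quot_oneE -quot_mulE mulg1. Qed.

Fact quot_mulV : left_inverse quot_one quot_inv quot_mul.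
Proof.
by move=> x; rewrite -[x]reprK -quot_invE -quot_mulE mulVg quot_oneE.
Qed.

Fact quot_Vmul : right_inverse quot_one quot_inv quot_mul.
Proof.
by move=> x; rewrite -[x]reprK -quot_invE -quot_mulE mulgV quot_oneE.
Qed.

HB.instance Definition _ :=
  isGroup.Build Q quot_mulA quot_mul1 quot_1mul quot_mulV quot_Vmul.

Fact quot_piM : {morph \pi_Q : x y / x * y}.
Proof. exact: quot_mulE. Qed.

HB.instance Definition _ := isMultiplicative.Build G Q \pi_Q quot_piM.

Variable phi : {multiplicative G -> G}.
Hypothesis phiH : forall x, x \in H -> phi x \in H.

(* The invariance argument makes the map independent of the representatives     *)
(* chosen by [lift_op1]: see [quot_endoE].                                     *)
Definition quot_endo of (forall x, x \in H -> phi x \in H) : Q -> Q :=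
  lift_op1 Q phi.

Lemma quot_endoE : {morph \pi_Q : x / phi x >-> quot_endo phiH x}.
Proof.
unlock quot_endo => x; apply/quot_eqP.
have xH : x^-1 * repr (\pi_Q x) \in H by apply/quot_eqP; rewrite reprK.
have phiV : phi x^-1 = (phi x)^-1.
  apply: (mulIg (phi x)); rewrite -gmulfM !mulVg.
  by apply: (mulIg (phi 1)); rewrite -gmulfM !mul1g.
by rewrite -phiV -gmulfM; exact: phiH.
Qed.

Fact quot_endoM : {morph quot_endo phiH : x y / x * y}.
Proof.
move=> x y; rewrite -[x]reprK -[y]reprK -quot_piM -!quot_endoE.
by rewrite gmulfM quot_piM.
Qed.

HB.instance Definition _ :=
  isMultiplicative.Build Q Q (quot_endo phiH) quot_endoM.

End Quotient.
Arguments quot_endo {G H} nH {phi} _ _.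

Section AlgebraicEntropy.
Local Open Scope fset_scope.
Local Open Scope classical_set_scope.
Local Open Scope ereal_scope.
Local Open Scope ring_scope.

Definition fset_mul (G : groupType) (A B : {fset G}) : {fset G} :=
  [fset (x * y)%g | x in A, y in B]%fset.

(* U phi(U) ... phi^(n-1)(U); for n = 0 the empty product is {1}. *)
Definition trajectory (G : groupType) (phi : {multiplicative G -> G})
    (U : {fset G}) (n : nat) : {fset G} :=
  \big[@fset_mul G/[fset 1%g]%fset]_(i < n) [fset iter i phi x | x in U]%fset.

(* The term n = 0, where division by zero gives 0, does not affect the limsup. *)
Definition entropy_at (R : realType) (G : groupType)
    (phi : {multiplicative G -> G}) (U : {fset G}) : \bar R :=
  limn_esup (fun n : nat => (ln (#|` trajectory phi U n|%:R : R) / n%:R)%:E).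

Definition alg_entropy (R : realType) (G : groupType)
    (phi : {multiplicative G -> G}) : \bar R :=
  ereal_sup [set entropy_at R phi U | U in [set U : {fset G} | 1%g \in U]].

End AlgebraicEntropy.

(* Main.v *)
From HB Require Import structures.
Require Import Defs.
From mathcomp Require Import all_boot all_order all_algebra.
From mathcomp Require Import finmap.
From mathcomp Require Import all_classical all_reals all_analysis.
From mathcomp Require Import zify ring.

(** A Hamiltonian group is torsion: if [a] and [b] do not commute, then
  [c = [~ a, b]] lies in both normal subgroups <a> and <b>, so it commutes with
  [a] and with [b], and conjugating a relation [c = a ^+ m / a ^+ n] by [b]
  gives [c ^+ m = c ^+ n], a nontrivial relation on [a].  A product of finitely
  many finite normal cyclic subgroups being finite, every finite subset lies in
  a finite subgroup; and all finite subgroups are normal.  Additivity follows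
  from these two properties of G, for any short exact sequence
  1 -> N -> G -> Q -> 1 with compatible endomorphisms sigma, phi, psi
  ([alg_entropy_exact]).

  Let F be a finite subgroup and T_n its trajectory, so that all T_n are finite
  subgroups and T_(n+2) = T_(n+1) phi(T_(n+1)).  Counting pairs gives
    |T_(n+1)|^2 = |T_(n+2)| |T_(n+1) :&: phi^-1(T_(n+1))|,
  and the last set contains T_n.  The indices |T_(n+1)| / |T_n| are therefore
  nonincreasing integers, hence eventually equal to some a, and
  H(phi, F) = ln a is an actual limit ([entropy_at_ratio]).

  Let f : G -> Q be the projection and K_n = T_n :&: ker f.  Then f(T_n) is the
  trajectory of f(F), and |T_n| = |f(T_n)| |K_n|.  Once the indices of T_n and
  of f(T_n) are constant, T_(n+1) :&: phi^-1(T_(n+1)) = T_n; this equality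
  restricts to the kernels, and the same counting gives
  K_(n+2) = K_(n+1) phi(K_(n+1)) ([kernel_step]).  So from some m on the K_n are
  the trajectory of the finite subgroup K_(m+1) of N, and
  H(phi, F) = H(sigma, K_(m+1)) + H(psi, f(F)) ([entropy_at_exact]); this is the
  inequality <=, since enlarging F does not decrease H(phi, F).  Conversely,
  finite subsets U of N and V of Q are dominated by
  F :&: ker f and f(F) for one finite subgroup F of G, and
  |T_n(F :&: ker f)| |T_n(f(F))| <= |T_n(F)|; since all three growth rates are
  limits, the inequality >= follows ([entropy_at_add_le]). *)

Set Implicit Arguments.
Unset Strict Implicit.
Unset Printing Implicit Defensive.
Import Order.TTheory GRing.Theory Num.Theory.
Import numFieldNormedType.Exports.

Local Open Scope fset_scope.
Local Open Scope group_scope.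
Local Open Scope quotient_scope.

(** * Finite subgroups *)

Definition finsubgroup (G : groupType) (A : {fset G}) : Prop :=
  1 \in A /\ forall x y, x \in A -> y \in A -> x / y \in A.

Section FiniteSubgroup.
Variables (G : groupType) (A : {fset G}).
Hypothesis gA : finsubgroup A.

Lemma finsubgroup1 : 1 \in A. Proof. exact: gA.1. Qed.

Lemma finsubgroupV x : x \in A -> x^-1 \in A.
Proof. by move=> xA; rewrite -div1g; apply: gA.2 => //; exact: gA.1. Qed.

Lemma finsubgroupM x y : x \in A -> y \in A -> x * y \in A.
Proof. by move=> xA yA; rewrite -[y]invgK; apply: gA.2 => //; exact: finsubgroupV. Qed.

End FiniteSubgroup.

Lemma finsubgroup_triv (G : groupType) : finsubgroup [fset (1 : G)].
Proof. by split=> [|x y]; rewrite !inE // => /eqP-> /eqP->; rewrite mulgV. Qed.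

Section Morphism.
Variables (G K : groupType) (f : {multiplicative G -> K}).

Lemma morph1 : f 1 = 1.
Proof. by apply: (mulIg (f 1)); rewrite -gmulfM !mul1g. Qed.

Lemma morphV x : f x^-1 = (f x)^-1.
Proof. by apply: (mulIg (f x)); rewrite -gmulfM !mulVg morph1. Qed.

Lemma finsubgroup_image (A : {fset G}) :
  finsubgroup A -> finsubgroup [fset f x | x in A].
Proof.
move=> gA; split; first by apply/imfsetP; exists 1; [exact: gA.1|rewrite morph1].
move=> _ _ /imfsetP[x /= xA ->] /imfsetP[y /= yA ->].
by apply/imfsetP; exists (x / y); [exact: gA.2|rewrite gmulfM morphV].
Qed.

Lemma image_fset_mul (A B : {fset G}) :
  [fset f x | x in fset_mul A B] = fset_mul [fset f x | x in A] [fset f x | x in B].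
Proof.
apply/fsetP => z; apply/imfsetP/imfset2P => /=.
  move=> [_ /imfset2P[x xA [y yB ->]] ->].
  by exists (f x); [exact: in_imfset|exists (f y); [exact: in_imfset|rewrite gmulfM]].
move=> [_ /imfsetP[x xA ->] [_ /imfsetP[y yB ->] ->]].
by exists (x * y); [exact: in_imfset2|rewrite gmulfM].
Qed.

End Morphism.

(** * Products and counting *)

Section Products.
Variable G : groupType.
Implicit Types A B C D : {fset G}.

Lemma mem_fset_mul A B x y : x \in A -> y \in B -> x * y \in fset_mul A B.
Proof. by move=> xA yB; apply/imfset2P; exists x => //; exists y. Qed.

Lemma fset_mulP A B z :
  reflect (exists x y, [/\ x \in A, y \in B & z = x * y]) (z \in fset_mul A B).
Proof.
apply: (iffP idP) => [/imfset2P[x /= xA [y /= yB ->]]|[x [y [xA yB ->]]]].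
  by exists x, y.
exact: mem_fset_mul.
Qed.

Lemma fset_mul1s A : fset_mul [fset 1] A = A.
Proof.
apply/fsetP => x; apply/fset_mulP/idP => [[y [z [+ zA ->]]]|xA].
  by rewrite inE => /eqP->; rewrite mul1g.
by exists 1, x; rewrite inE mul1g.
Qed.

Lemma fset_muls1 A : fset_mul A [fset 1] = A.
Proof.
apply/fsetP => x; apply/fset_mulP/idP => [[y [z [yA + ->]]]|xA].
  by rewrite inE => /eqP->; rewrite mulg1.
by exists x, 1; rewrite inE mulg1.
Qed.

Lemma fset_mulSS A B C D : A `<=` C -> B `<=` D -> fset_mul A B `<=` fset_mul C D.
Proof.
move=> /fsubsetP AC /fsubsetP BD; apply/fsubsetP => _ /fset_mulP[x [y [xA yB ->]]].
by apply: mem_fset_mul; [exact: AC|exact: BD].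
Qed.

Lemma fset_mul_sub_finsubgroup A B C :
  finsubgroup C -> A `<=` C -> B `<=` C -> fset_mul A B `<=` C.
Proof.
move=> gC /fsubsetP AC /fsubsetP BC; apply/fsubsetP => _ /fset_mulP[x [y [xA yB ->]]].
by apply: finsubgroupM => //; [exact: AC|exact: BC].
Qed.

Lemma finsubgroup_mul A B :
    (forall x g, x \in B -> x ^ g \in B) ->
  finsubgroup A -> finsubgroup B -> finsubgroup (fset_mul A B).
Proof.
move=> nB gA gB; split.
  by rewrite -[1]mul1g; apply: mem_fset_mul; exact: finsubgroup1.
move=> _ _ /fset_mulP[a [b [aA bB ->]]] /fset_mulP[c [d [cA dB ->]]].
have -> : (a * b) / (c * d) = (a / c) * (b / d) ^ c^-1.
  by rewrite conjgE invgK invgM !mulgA mulgVK.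
apply: mem_fset_mul; first exact: gA.2.
by apply: nB; exact: gB.2.
Qed.

End Products.

Lemma card_fibers (S T : choiceType) (A : {fset S}) (f : S -> T) (k : nat) :
    (forall x, x \in A -> #|` [fset y in A | f y == f x]| = k) ->
  #|` A| = (#|` [fset f x | x in A]| * k)%N.
Proof.
move=> fib; rewrite card_fset_sum1 (partition_big_imfset _ f) /=.
rewrite -sum1_size big_distrl /= big_seq_cond [RHS]big_seq_cond.
apply: eq_bigr => _ /andP[/imfsetP[x /= xA ->] _].
by rewrite mul1n -(fib x xA) card_fset_sum1 big_fset_condE.
Qed.

Lemma card_fsetM (S T : choiceType) (A : {fset S}) (B : {fset T}) :
  #|` A `*` B| = (#|` A| * #|` B|)%N.
Proof.
rewrite card_fset_sum1 big_imfset2 /=; last by move=> [? ?] [? ?] _ _ /= [-> ->].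
rewrite (eq_bigr (fun=> #|` B|)) => [|i _]; last by rewrite -card_fset_sum1.
by rewrite (card_fset_sum1 A) big_distrl /=; apply: eq_bigr => i _; rewrite mul1n.
Qed.

Section Counting.
Variable G : groupType.

(** For [f] the identity this is |A| |B| = |BA| |A :&: B|.  The pairs (b, a)
  are counted by their product [b * f a]: the fibre of a pair is the orbit of
  the pairs [(b / f n, n * a)], for [n] in [A :&: f @^-1 B]. *)
Lemma card_mul_image (K : groupType) (f : {multiplicative G -> K})
    (B : {fset K}) (A : {fset G}) :
    finsubgroup B -> finsubgroup A ->
  (#|` B| * #|` A| =
   #|` fset_mul B [fset f x | x in A]| * #|` [fset x in A | f x \in B]|)%N.
Proof.
move=> gB gA.
set N := [fset x in A | f x \in B].
pose g (u : K * G) := u.1 * f u.2.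
have -> : fset_mul B [fset f x | x in A] = [fset g u | u in B `*` A].
  apply/fsetP => z; apply/fset_mulP/imfsetP => /=.
    by move=> [b [_ [bB /imfsetP[a /= aA ->] ->]]]; exists (b, a); rewrite ?inE/= ?bB.
  move=> [[b a] /=]; rewrite inE /= => /andP[bB aA ->].
  by exists b, (f a); split=> //; exact: in_imfset.
rewrite -card_fsetM; apply: card_fibers => -[b a]; rewrite inE /= => /andP[bB aA].
have -> : [fset u in B `*` A | g u == g (b, a)] =
          [fset (b / f n, n * a) | n in N].
  apply/fsetP => -[c d]; apply/idP/imfsetP => /=.
    rewrite !inE /g /= => /andP[/andP[cB dA] /eqP cd].
    have bE : b = c * f d / f a by rewrite cd mulgK.
    have fda : f (d / a) = c^-1 * b by rewrite bE gmulfM morphV !mulgA mulVg mul1g.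
    exists (d / a); last by rewrite fda invgM invgK mulgVK mulgA mulgV mul1g.
    rewrite !inE /= fda gA.2//=.
    by apply: finsubgroupM => //; apply: finsubgroupV.
  move=> [n]; rewrite !inE /= => /andP[nA fnB] [-> ->].
  by rewrite gB.2//= finsubgroupM//= /g /= gmulfM mulgA mulgVK eqxx.
by rewrite card_imfset //= => m n [_ /mulIg].
Qed.

Lemma card_image_ker (K : groupType) (f : {multiplicative G -> K}) (A : {fset G}) :
    finsubgroup A ->
  #|` A| = (#|` [fset f x | x in A]| * #|` [fset x in A | f x == 1%g]|)%N.
Proof.
move=> gA; have := card_mul_image f (finsubgroup_triv K) gA; rewrite cardfs1 mul1n fset_mul1s => ->; congr (_ * _)%N.
by congr #|` _|; apply/fsetP => z; rewrite !inE.
Qed.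

(** Lagrange's theorem: [B] is fibred over the right cosets [A x]. *)
Lemma finsubgroup_dvd (A B : {fset G}) :
  finsubgroup A -> finsubgroup B -> A `<=` B -> (#|` A| %| #|` B|)%N.
Proof.
move=> gA gB /fsubsetP AB.
rewrite (@card_fibers _ _ B (fun x => fset_mul A [fset x]) #|` A|) ?dvdn_mull// => x xB.
have -> : [fset y in B | fset_mul A [fset y] == fset_mul A [fset x]] =
          [fset a * x | a in A].
  apply/fsetP => y; apply/idP/imfsetP => /=.
    rewrite !inE => /andP[yB /eqP yx].
    have : y \in fset_mul A [fset x].
      rewrite -yx -[X in X \in _]mul1g; apply: mem_fset_mul; last by rewrite inE.
      exact: finsubgroup1.
    by move=> /fset_mulP[a [z [aA + ->]]]; rewrite inE => /eqP->; exists a.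
  move=> [a aA ->]; rewrite !inE/= finsubgroupM//= ?AB//.
  apply/eqP/fsetP => z; apply/fset_mulP/fset_mulP => -[c [w [cA]]];
    rewrite inE => /eqP -> ->.
    by exists (c * a), x; rewrite inE mulgA finsubgroupM.
  by exists (c / a), (a * x); rewrite inE mulgA mulgVK gA.2.
by rewrite card_imfset //; exact: mulIg.
Qed.

End Counting.

(** * Trajectories *)

Section Naturality.
Variables (G K : groupType) (phi : {multiplicative G -> G}).
Variables (psi : {multiplicative K -> K}) (f : {multiplicative G -> K}).
Hypothesis fphi : forall x, f (phi x) = psi (f x).

(** Applied to the inclusion of a subgroup, to a quotient map, and to [phi]
  itself as a map commuting with [phi]. *)
Lemma image_trajectory U n :
  [fset f x | x in trajectory phi U n] = trajectory psi [fset f x | x in U] n.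
Proof.
have img1 : [fset f x | x in [fset (1 : G)]] = [fset 1].
  by rewrite imfset_fset1 morph1.
rewrite /trajectory.
rewrite (big_morph (fun A : {fset G} => [fset f x | x in A]) (@image_fset_mul _ _ f) img1).
apply: eq_bigr => i _; rewrite -!imfset_comp; apply: eq_imfset => //= x.
by elim: (i : nat) => //= m IHm; rewrite fphi IHm.
Qed.

End Naturality.

Section Trajectories.
Variables (G : groupType) (phi : {multiplicative G -> G}).
Implicit Types U V : {fset G}.
Local Notation T := (trajectory phi).

Lemma trajectory0 U : T U 0 = [fset 1].
Proof. by rewrite /trajectory big_ord0. Qed.

Lemma trajectoryS U n : T U n.+1 = fset_mul U [fset phi x | x in T U n].
Proof.
rewrite {1}/trajectory big_ord_recl imfset_id; congr fset_mul.
rewrite (image_trajectory (psi := phi)) // /trajectory; apply: eq_bigr => i _.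
rewrite -imfset_comp; apply: eq_imfset => //= x.
by elim: (i : nat) => //= m ->.
Qed.

Lemma trajectory1 U : T U 1 = U.
Proof. by rewrite trajectoryS trajectory0 imfset_fset1 morph1 fset_muls1. Qed.

Lemma trajectory_triv n : T [fset 1] n = [fset 1].
Proof.
elim: n => [|n IHn]; first by rewrite trajectory0.
by rewrite trajectoryS IHn imfset_fset1 morph1 fset_mul1s.
Qed.

Lemma trajectoryUS U V n : U `<=` V -> T U n `<=` T V n.
Proof.
move=> UV; elim: n => [|n IHn]; first by rewrite !trajectory0.
by rewrite !trajectoryS fset_mulSS// subset_imfset//; exact/fsubsetP.
Qed.

Lemma trajectory_has1 U n : 1 \in U -> 1 \in T U n.
Proof.
move=> U1; elim: n => [|n IHn]; first by rewrite trajectory0 inE.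
rewrite trajectoryS -[1]mul1g mem_fset_mul// -(morph1 phi).
by apply/imfsetP; exists 1.
Qed.

Lemma image_trajectory_sub U n : 1 \in U -> [fset phi x | x in T U n] `<=` T U n.+1.
Proof.
move=> U1; rewrite trajectoryS; apply/fsubsetP => x xT.
by rewrite -[x]mul1g mem_fset_mul.
Qed.

Lemma trajectory_subS U n : 1 \in U -> T U n `<=` T U n.+1.
Proof.
move=> U1; elim: n => [|n IHn].
  by rewrite trajectory0 fsub1set trajectory_has1.
by rewrite trajectoryS [T U n.+2]trajectoryS fset_mulSS// subset_imfset//; exact/fsubsetP.
Qed.

Lemma trajectory_sub U n : 1 \in U -> U `<=` T U n.+1.
Proof.
move=> U1; rewrite trajectoryS; apply/fsubsetP => x xU.
rewrite -[x]mulg1 mem_fset_mul// -(morph1 phi).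
by apply/imfsetP; exists 1 => //=; exact: trajectory_has1.
Qed.

Lemma card_trajectory_gt0 U n : 1 \in U -> (0 < #|` T U n|)%N.
Proof. by move=> U1; rewrite cardfs_gt0; apply/fset0Pn; exists 1; exact: trajectory_has1. Qed.

(** The product by [phi (T U n.+1)] on the right adds the single factor
  [phi^(n+1) (U)]: the inclusion from left to right holds because [U] is the
  first factor of [T U n.+1], the other one because [T U n.+2] is a subgroup
  that contains both factors.  The index starts at 1 because the trajectory of
  length 0 does not contain [U]. *)
Lemma trajectorySS U n : 1 \in U -> finsubgroup (T U n.+2) ->
  T U n.+2 = fset_mul (T U n.+1) [fset phi x | x in T U n.+1].
Proof.
move=> U1 gT; apply/eqP; rewrite eqEfsubset; apply/andP; split.
  by rewrite {1}trajectoryS fset_mulSS// trajectory_sub.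
by apply: fset_mul_sub_finsubgroup => //; [exact: trajectory_subS|exact: image_trajectory_sub].
Qed.

End Trajectories.

(** * Sequences with eventually constant ratio *)

Definition eventual_ratio (t : nat -> nat) (a : nat) : Prop :=
  exists N : nat, forall n : nat, (N <= n)%N -> t n.+1 = (a * t n)%N.

(** The quotients t (n + 1) / t n are natural numbers and do not increase, so
  they are constant from the first place where they reach their minimum. *)
Lemma eventual_ratio_logconcave (t : nat -> nat) :
    (forall n, (0 < t n)%N) -> (forall n, (t n %| t n.+1)%N) ->
    (forall n, (t n.+2 * t n <= t n.+1 * t n.+1)%N) ->
  exists a, eventual_ratio t a.
Proof.
move=> t_gt0 t_dvd t_conc; pose q n := (t n.+1 %/ t n)%N.
have tE n : t n.+1 = (q n * t n)%N by rewrite divnK.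
have qS n : (q n.+1 <= q n)%N.
  have tt_gt0 : (0 < t n.+1 * t n)%N by rewrite muln_gt0 !t_gt0.
  rewrite -(leq_pmul2r tt_gt0) mulnA -tE mulnCA -tE.
  exact: t_conc.
have q_decr m n : (m <= n)%N -> (q n <= q m)%N.
  by move=> /subnK <-; elim: (n - m)%N => // k /(leq_trans _) -> //; exact: qS.
have q_ex : exists v, `[< exists n, q n = v >].
  by exists (q 0%N); apply/asboolP; exists 0%N.
case: (ex_minnP q_ex) => v vE v_min.
move/asboolP: vE => [N qN]; exists v, N => n Nn.
rewrite tE; congr (_ * _)%N; apply/eqP; rewrite eqn_leq -{1}qN q_decr//=.
by apply: v_min; apply/asboolP; exists n.
Qed.

(** This form of the eventual constancy passes to quotients of two sequences
  without division. *)
Lemma eventual_ratio_geometric (t : nat -> nat) : (exists a, eventual_ratio t a) ->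
  exists m, forall n, (m <= n)%N -> (t n.+2 * t n = t n.+1 * t n.+1)%N.
Proof.
move=> [a [m tE]]; exists m => n mn.
by rewrite (tE n.+1) ?(leq_trans mn)// {2}(tE n)// mulnAC mulnC mulnA.
Qed.

(** * Growth rates and entropy *)

Section Entropy.
Variable R : realType.
Local Open Scope classical_set_scope.
Local Open Scope ring_scope.

(** From [N] on, [ln (t n) = c + n * ln a] for a constant [c]. *)
Lemma cvg_log_eventual_ratio (t : nat -> nat) (a : nat) :
    (forall n, (0 < t n)%N) -> eventual_ratio t a ->
  (fun n => ln ((t n)%:R : R) / n%:R) @ \oo --> ln (a%:R : R).
Proof.
move=> t_gt0 [N tE].
have a_gt0 : (0 < a)%N.
  by have := t_gt0 N.+1; rewrite tE// muln_gt0 => /andP[].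
have lnS k : ln ((t (N + k)%N)%:R : R) = ln (t N)%:R + ln a%:R *+ k.
  elim: k => [|k IHk]; first by rewrite addn0 mulr0n addr0.
  rewrite addnS tE ?leq_addr// natrM lnM ?posrE ?ltr0n// IHk mulrSr; ring.
pose c : R := ln (t N)%:R - ln a%:R *+ N.
have lim : (fun n : nat => ln (a%:R : R) + c * n%:R^-1) @ \oo --> ln (a%:R : R).
  rewrite -[X in _ --> X]addr0 -(mulr0 c); apply: cvgD; first exact: cvg_cst.
  apply: cvgMr.
  rewrite -cvg_shiftS; exact: cvg_harmonic.
apply: cvg_trans lim; apply: near_eq_cvg; near=> n.
have Nn : (N <= n)%N by near: n; exact: nbhs_infty_ge.
have n0 : (0 < n)%N by near: n; exact: nbhs_infty_gt.
rewrite -(subnKC Nn) lnS subnKC// mulrnBr// /c.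
have : (n%:R : R) != 0 by rewrite pnatr_eq0 -lt0n.
move=> nn; rewrite -[ln a%:R *+ n]mulr_natr; field.
by [].
Unshelve. all: by end_near. Qed.

Local Open Scope ereal_scope.

Lemma le_limn_esup (u v : nat -> \bar R) :
  (forall n, u n <= v n) -> limn_esup u <= limn_esup v.
Proof.
move=> uv; rewrite !limn_esup_lim; apply: lee_lim; try exact: is_cvg_esups.
apply: nearW => n; apply: ge_ereal_sup => _ [m nm <-].
by apply: le_ereal_sup_tmp; exists (v m) => //; exists m.
Qed.

(** If [z] is a real number then nonnegativity makes all the elements of [X] and
  [Y] finite, so that one summand at a time can be moved to the right. *)
Lemma ereal_sup_add_le (X Y : set (\bar R)) (z : \bar R) :
    X !=set0 -> Y !=set0 -> (forall x, X x -> 0 <= x) -> (forall y, Y y -> 0 <= y) ->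
    (forall x y, X x -> Y y -> x + y <= z) ->
  ereal_sup X + ereal_sup Y <= z.
Proof.
move=> [x0 Xx0] [y0 Yy0] X0 Y0 XYz.
have z0 : 0 <= z by rewrite (le_trans _ (XYz _ _ Xx0 Yy0))// adde_ge0//; [exact: X0|exact: Y0].
move: z XYz z0 => [z||] XYz z0 //; last by rewrite leey.
have Yfin y : Y y -> y \is a fin_num.
  move=> Yy; rewrite ge0_fin_numE ?Y0//; apply: le_lt_trans (ltry z).
  by apply: le_trans (XYz _ _ Xx0 Yy); rewrite leeDr ?X0.
have supX y : Y y -> ereal_sup X <= z%:E - y.
  move=> Yy; apply: ge_ereal_sup => x Xx.
  by rewrite leeBrDr ?Yfin// XYz.
have supXfin : ereal_sup X \is a fin_num.
  rewrite ge0_fin_numE; last by apply: le_ereal_sup_tmp; exists x0; rewrite ?X0.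
  apply: le_lt_trans (supX _ Yy0) _.
  by have := Yfin _ Yy0; case: y0 {Yy0} => // r _; rewrite ltry.
rewrite addeC -leeBrDr//; apply: ge_ereal_sup => y Yy.
by rewrite leeBrDr// addeC -leeBrDr ?Yfin ?supX.
Qed.

Lemma entropy_at_ratio (G : groupType) (phi : {multiplicative G -> G})
    (U : {fset G}) a :
    (1%g \in U)%fset -> eventual_ratio (fun n => #|` trajectory phi U n|) a ->
  entropy_at R phi U = (ln (a%:R : R))%:E.
Proof.
move=> U1 ra.
rewrite /entropy_at; apply: (cvg_limn_einf_sup _).2.
apply/fine_cvgP; split; first exact: nearW.
apply: (cvg_log_eventual_ratio (t := fun n => #|` trajectory phi U n|)) => // n.
exact: card_trajectory_gt0.
Qed.

Lemma entropy_at_ge0 (G : groupType) (phi : {multiplicative G -> G}) (U : {fset G}) :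
  (1%g \in U)%fset -> 0 <= entropy_at R phi U.
Proof.
move=> U1; rewrite /entropy_at limn_esup_lim; apply: lime_ge; first exact: is_cvg_esups.
apply: nearW => n; apply: le_ereal_sup_tmp.
exists (ln (#|` trajectory phi U n|%:R : R) / n%:R)%:E; first by exists n => /=.
by rewrite lee_fin divr_ge0// ln_ge0// ler1n card_trajectory_gt0.
Qed.

Lemma entropy_at_le (G K : groupType) (phi : {multiplicative G -> G})
    (psi : {multiplicative K -> K}) (U : {fset G}) (V : {fset K}) :
    (1%g \in U)%fset ->
    (forall n, (#|` trajectory phi U n| <= #|` trajectory psi V n|)%N) ->
  entropy_at R phi U <= entropy_at R psi V.
Proof.
move=> U1 UV; apply: le_limn_esup => n; rewrite lee_fin ler_wpM2r ?invr_ge0//.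
have U0 := card_trajectory_gt0 phi n U1.
by rewrite ler_ln ?posrE ?ltr0n ?ler_nat ?UV//; apply: leq_trans (UV n).
Qed.

(** A supremum limit is only subadditive; the inequality in this direction holds
  because the three logarithmic rates are limits. *)
Lemma ln_ratioD_le (s t u : nat -> nat) a b c :
    (forall n, (0 < s n)%N) -> (forall n, (0 < t n)%N) ->
    (forall n, (s n * t n <= u n)%N) ->
    eventual_ratio s a -> eventual_ratio t b -> eventual_ratio u c ->
  (ln (a%:R : R) + ln (b%:R : R) <= ln (c%:R : R))%R.
Proof.
move=> s0 t0 stu ra rb rc.
have u0 n : (0 < u n)%N by apply: leq_trans (stu n); rewrite muln_gt0 s0 t0.
apply: ler_cvg_to (cvgD (cvg_log_eventual_ratio s0 ra) (cvg_log_eventual_ratio t0 rb))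
  (cvg_log_eventual_ratio u0 rc) _.
apply: nearW => n; rewrite -[leLHS]/(ln (s n)%:R / n%:R + ln (t n)%:R / n%:R)%R.
rewrite -mulrDl ler_wpM2r ?invr_ge0//.
by rewrite -lnM ?posrE ?ltr0n// -natrM ler_ln ?posrE ?ltr0n ?ler_nat// muln_gt0 s0 t0.
Qed.

End Entropy.

(** * Trajectories of finite subgroups *)

Definition locally_finite (G : groupType) : Prop :=
  forall U : {fset G}, exists2 F : {fset G}, finsubgroup F & U `<=` F.

Definition finsubgroups_normal (G : groupType) : Prop :=
  forall F : {fset G}, finsubgroup F -> forall x g, x \in F -> x ^ g \in F.

Lemma finsubgroup_trajectory (G : groupType) (phi : {multiplicative G -> G}) F :
  finsubgroups_normal G -> finsubgroup F ->
  forall n, finsubgroup (trajectory phi F n).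
Proof.
move=> nG gF; elim=> [|n IHn]; first by rewrite trajectory0; exact: finsubgroup_triv.
have gphi := finsubgroup_image phi IHn.
by rewrite trajectoryS; apply: finsubgroup_mul => //; exact: nG.
Qed.

(** The set on the right contains the trajectory of length [n]
  ([trajectory_sub_preimage]): this makes the sequence of cardinals log-concave,
  and equality holds exactly when the two sets are equal. *)
Lemma card_trajectory_step (G : groupType) (phi : {multiplicative G -> G}) U n :
    1 \in U -> (forall n, finsubgroup (trajectory phi U n)) ->
  (#|` trajectory phi U n.+1| * #|` trajectory phi U n.+1| =
   #|` trajectory phi U n.+2| *
   #|` [fset x in trajectory phi U n.+1 | phi x \in trajectory phi U n.+1]|)%N.
Proof. by move=> U1 gT; rewrite trajectorySS// -card_mul_image. Qed.

Lemma trajectory_sub_preimage (G : groupType) (phi : {multiplicative G -> G}) U n :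
    1 \in U ->
  trajectory phi U n `<=`
    [fset x in trajectory phi U n.+1 | phi x \in trajectory phi U n.+1].
Proof.
move=> U1; apply/fsubsetP => x xT; rewrite !inE /=.
rewrite (fsubsetP (trajectory_subS phi n U1))//=.
by apply: (fsubsetP (image_trajectory_sub phi n U1)); exact: in_imfset.
Qed.

Lemma trajectory_eventual_ratio (G : groupType) (phi : {multiplicative G -> G}) U :
    1 \in U -> (forall n, finsubgroup (trajectory phi U n)) ->
  exists a, eventual_ratio (fun n => #|` trajectory phi U n|) a.
Proof.
move=> U1 gT; apply: eventual_ratio_logconcave => n.
- exact: card_trajectory_gt0.
- by apply: finsubgroup_dvd => //; exact: trajectory_subS.
- rewrite card_trajectory_step// leq_mul2l; apply/orP; right.
  by apply: fsubset_leq_card; exact: trajectory_sub_preimage.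
Qed.

(** * Additivity on short exact sequences *)

Lemma fset_lift (S : groupType) (T : choiceType) (f : S -> T) (C : {fset T}) :
  (forall y, y \in C -> exists x, f x = y) -> exists A : {fset S}, [fset f x | x in A] = C.
Proof.
move=> Cf; have /choice[g fg] : forall y, exists x, y \in C -> f x = y.
  by move=> y; case: (boolP (y \in C)) => [/Cf[x fx]|_]; [exists x|exists 1].
exists [fset g y | y in C]; rewrite -imfset_comp -[RHS]imfset_id.
by apply: eq_in_imfset => // y /fg.
Qed.

Section ShortExactSequence.
Variables (R : realType) (N G Q : groupType).
Variables (sigma : {multiplicative N -> N}) (phi : {multiplicative G -> G}).
Variables (psi : {multiplicative Q -> Q}).
Variables (i : {multiplicative N -> G}) (f : {multiplicative G -> Q}).
Hypothesis i_inj : injective i.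
Hypothesis f_surj : forall q, exists x, f x = q.
Hypothesis im_i_ker_f : forall x, f x = 1 <-> exists u, i u = x.
Hypothesis isigma : forall u, i (sigma u) = phi (i u).
Hypothesis fphi : forall x, f (phi x) = psi (f x).
Hypothesis lfG : locally_finite G.
Hypothesis nG : finsubgroups_normal G.

Local Notation kerf A := [fset x in A | f x == 1%g].

Lemma finsubgroup_kernel (A : {fset G}) : finsubgroup A -> finsubgroup (kerf A).
Proof.
move=> gA; split=> [|x y]; rewrite !inE /=.
  by rewrite finsubgroup1//= morph1.
move=> /andP[xA /eqP fx] /andP[yA /eqP fy].
by rewrite gA.2//= gmulfM morphV fx fy mulgV.
Qed.

Lemma card_trajectory_inj U V n : [fset i u | u in U] = V ->
  #|` trajectory sigma U n| = #|` trajectory phi V n|.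
Proof.
move=> <-; rewrite -(image_trajectory (psi := phi) (f := i) isigma).
by rewrite card_imfset.
Qed.

Section Kernels.
Variable F : {fset G}.
Hypothesis gF : finsubgroup F.
Local Notation T n := (trajectory phi F n).
Local Notation K n := (kerf (T n)).
Local Notation F1 := (finsubgroup1 gF).
Let gT := finsubgroup_trajectory phi nG gF.

Lemma card_trajectory_kernel n :
  #|` T n| = (#|` trajectory psi [fset f x | x in F] n| * #|` K n|)%N.
Proof. by rewrite {1}(card_image_ker f (gT n)) (image_trajectory fphi). Qed.

Lemma image_traj_finsubgroup n : finsubgroup (trajectory psi [fset f x | x in F] n).
Proof. by rewrite -(image_trajectory fphi); exact: finsubgroup_image. Qed.

Lemma image1 : 1 \in [fset f x | x in F].
Proof. by apply/imfsetP; exists 1; [exact: F1|rewrite morph1]. Qed.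

Lemma kernel_subS n : K n `<=` K n.+1.
Proof.
apply/fsubsetP => x; rewrite !inE /= => /andP[xT ->].
by rewrite (fsubsetP (trajectory_subS phi n F1)).
Qed.

Lemma kernel_image_sub n : [fset phi x | x in K n] `<=` K n.+1.
Proof.
apply/fsubsetP => _ /imfsetP[x + ->]; rewrite !inE /= => /andP[xT /eqP fx].
rewrite fphi fx morph1 eqxx andbT.
by apply: (fsubsetP (image_trajectory_sub phi n F1)); exact: in_imfset.
Qed.

(** Let t, q, k be the cardinals of the trajectories of [F] and of [f F], and of
  the kernels, so that t = q k.  For large n both t and q satisfy
  t (n + 2) t n = t (n + 1) ^ 2, hence so does k.  The equality for t says that
  the elements of [T n.+1] mapped by [phi] into [T n.+1] are those of [T n];
  the same then holds for the kernels, and [card_mul_image] gives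
  k (n + 1) ^ 2 = |K (n + 1) phi (K (n + 1))| k n, so the product has the
  cardinal k (n + 2) of the set [K n.+2] that contains it. *)
Lemma kernel_step : exists m, forall n, (m <= n)%N ->
  K n.+2 = fset_mul (K n.+1) [fset phi x | x in K n.+1].
Proof.
have [m1 tE] := eventual_ratio_geometric (trajectory_eventual_ratio F1 gT).
have [m2 qE] := eventual_ratio_geometric
  (trajectory_eventual_ratio image1 image_traj_finsubgroup).
exists (maxn m1 m2) => n; rewrite geq_max => /andP[m1n m2n].
have T0 k : (0 < #|` T k|)%N by exact: card_trajectory_gt0 F1.
have Q0 k : (0 < #|` trajectory psi [fset f x | x in F] k|)%N.
  exact: card_trajectory_gt0 image1.
have TE : [fset x in T n.+1 | phi x \in T n.+1] = T n.
  apply/esym/eqP; rewrite eqEfcard trajectory_sub_preimage ?F1//=.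
  rewrite -(leq_pmul2l (T0 n.+2)) -card_trajectory_step ?F1//.
  by rewrite tE.
have KE : [fset x in K n.+1 | phi x \in K n.+1] = K n.
  apply/fsetP => x; apply/idP/idP.
    rewrite -TE !inE /= => /andP[/andP[-> ->] /andP[-> _]] //.
  move=> xK; rewrite inE /= inE /= (fsubsetP (kernel_subS n))//=.
  by apply: (fsubsetP (kernel_image_sub n)); exact: in_imfset.
have gK k : finsubgroup (K k) by exact: finsubgroup_kernel.
have := card_mul_image phi (gK n.+1) (gK n.+1); rewrite KE => cK.
apply/esym/eqP; rewrite eqEfcard; apply/andP; split.
  by apply: fset_mul_sub_finsubgroup => //; [exact: kernel_subS|exact: kernel_image_sub].
have K0 : (0 < #|` K n|)%N by have := T0 n; rewrite card_trajectory_kernel muln_gt0 => /andP[].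
rewrite -(leq_pmul2r K0) -cK.
pose q k := #|` trajectory psi [fset f x | x in F] k|.
have q1_gt0 : (0 < q n.+1 * q n.+1)%N by rewrite muln_gt0 !Q0.
rewrite -(leq_pmul2l q1_gt0) [leqRHS]mulnACA -!card_trajectory_kernel.
by rewrite -qE// mulnACA -!card_trajectory_kernel tE.
Qed.

(** The kernel of the trajectory is itself a trajectory, up to a shift, of one of
  its finite stages. *)
Lemma trajectory_kernel : exists m, forall k,
  trajectory phi (K m.+1) k.+1 = K (m.+1 + k)%N.
Proof.
have [m KE] := kernel_step; exists m; elim=> [|k IHk].
  by rewrite trajectory1 addn0.
have gK := finsubgroup_kernel (gT m.+1).
rewrite trajectorySS; [|exact: finsubgroup1|exact: finsubgroup_trajectory].
by rewrite IHk addnS addSn KE// leq_addr.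
Qed.

(** [A] is a late kernel [K m.+1], seen in [N].  With a, b, c the eventual ratios
  of [F], of [f F] and of [A], the factorization of the cardinals gives
  a = c b. *)
Lemma entropy_at_exact : exists2 A : {fset N}, 1 \in A &
  entropy_at R phi F =
    (entropy_at R sigma A + entropy_at R psi [fset f x | x in F])%E.
Proof.
have [m KE] := trajectory_kernel.
have gK := finsubgroup_kernel (gT m.+1).
have [|A AK] := @fset_lift _ _ i (K m.+1).
  by move=> x; rewrite !inE /= => /andP[_ /eqP /im_i_ker_f].
have A1 : 1 \in A.
  have := finsubgroup1 gK; rewrite -AK => /imfsetP[u /= uA].
  by rewrite -(morph1 i) => /i_inj ->.
exists A => //.
have [a ra] := trajectory_eventual_ratio F1 gT.
have [b rb] := trajectory_eventual_ratio image1 image_traj_finsubgroup.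
have [c rc] := trajectory_eventual_ratio (finsubgroup1 gK)
                 (finsubgroup_trajectory phi nG gK).
rewrite (entropy_at_ratio R F1 ra) (entropy_at_ratio R image1 rb).
rewrite (entropy_at_ratio (a := c) R A1); last first.
  have [M cE] := rc; exists M => n Mn.
  by rewrite !(card_trajectory_inj _ AK) cE.
have T0 k : (0 < #|` T k|)%N by exact: card_trajectory_gt0 F1.
have acb : a = (c * b)%N.
  move: ra rb rc => [m1 aE] [m2 bE] [m3 cE].
  (* n is beyond the three thresholds from which the ratios are constant. *)
  pose n := (m1 + m2 + m3)%N.
  have := cE n.+1; rewrite !KE addnS => kE.
  have := aE (m.+1 + n)%N; rewrite card_trajectory_kernel bE ?kE; try lia.
  rewrite card_trajectory_kernel => tE.
  apply/eqP; rewrite -(eqn_pmul2r (T0 (m.+1 + n)%N)) card_trajectory_kernel.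
  by apply/eqP; rewrite -tE; last lia; rewrite mulnACA [(b * c)%N]mulnC.
have : (0 < a)%N.
  have [m1 aE] := ra; have := T0 m1.+1; have /= -> := aE m1 (leqnn _).
  by rewrite muln_gt0 => /andP[].
by rewrite acb muln_gt0 => /andP[c0 b0]; rewrite -EFinD natrM lnM ?posrE ?ltr0n.
Qed.

(** The trajectory of [F :&: ker f] lies in the kernel of the trajectory of [F],
  because its image under [f] is trivial. *)
Lemma entropy_at_add_le (U : {fset N}) (V : {fset Q}) :
    1 \in U -> 1 \in V -> [fset i u | u in U] `<=` F ->
    V `<=` [fset f x | x in F] ->
  (entropy_at R sigma U + entropy_at R psi V <= entropy_at R phi F)%E.
Proof.
move=> U1 V1 UF VF.
have gK := finsubgroup_kernel gF.
have [a ra] := trajectory_eventual_ratio F1 gT.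
have [b rb] := trajectory_eventual_ratio image1 image_traj_finsubgroup.
have [c rc] := trajectory_eventual_ratio (finsubgroup1 gK)
                 (finsubgroup_trajectory phi nG gK).
have hU : (entropy_at R sigma U <= entropy_at R phi (kerf F))%E.
  apply: entropy_at_le => // n; rewrite (card_trajectory_inj n (erefl _)).
  apply/fsubset_leq_card/trajectoryUS/fsubsetP => x xU.
  rewrite !inE (fsubsetP UF)//=; apply/eqP/im_i_ker_f.
  by move/imfsetP: xU => [u _ ->]; exists u.
have hV : (entropy_at R psi V <= entropy_at R psi [fset f x | x in F])%E.
  by apply: entropy_at_le => // n; apply/fsubset_leq_card/trajectoryUS.
apply: le_trans (leeD hU hV) _.
rewrite (entropy_at_ratio R F1 ra) (entropy_at_ratio R image1 rb).
rewrite (entropy_at_ratio R (finsubgroup1 gK) rc) -EFinD lee_fin.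
apply: ln_ratioD_le rc rb ra => n.
- by apply: card_trajectory_gt0; exact: finsubgroup1.
- exact: card_trajectory_gt0 image1.
rewrite mulnC card_trajectory_kernel leq_mul2l; apply/orP; right.
apply/fsubset_leq_card/fsubsetP => x xT; rewrite !inE /=.
have -> : x \in T n.
  by apply: fsubsetP xT; apply/trajectoryUS/fsubsetP => y; rewrite !inE => /andP[].
have : f x \in [fset f x | x in trajectory phi (kerf F) n] by exact: in_imfset.
rewrite (image_trajectory fphi).
suff -> : [fset f x | x in kerf F] = [fset 1] by rewrite trajectory_triv inE.
apply/fsetP => y; rewrite inE; apply/imfsetP/eqP => /= [[z]|->].
  by rewrite !inE => /andP[_ /eqP fz] ->.
by exists 1; rewrite ?morph1// finsubgroup1.
Qed.

End Kernels.

Theorem alg_entropy_exact :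
  (alg_entropy R phi = alg_entropy R sigma + alg_entropy R psi)%E.
Proof.
apply/eqP; rewrite eq_le; apply/andP; split.
  apply: ge_ereal_sup => _ [U U1 <-].
  have [F gF UF] := lfG U.
  have [A A1 FE] := entropy_at_exact gF.
  apply: (@le_trans _ _ (entropy_at R phi F)).
    by apply: entropy_at_le => // n; apply/fsubset_leq_card/trajectoryUS.
  rewrite FE; apply: leeD; apply: ereal_sup_ubound.
    by exists A.
  by exists [fset f x | x in F] => //; exact: image1.
apply: ereal_sup_add_le.
- by exists (entropy_at R sigma [fset 1]), [fset 1] => //=; rewrite inE.
- by exists (entropy_at R psi [fset 1]), [fset 1] => //=; rewrite inE.
- by move=> _ [U U1 <-]; exact: entropy_at_ge0.
- by move=> _ [U U1 <-]; exact: entropy_at_ge0.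
move=> _ _ [U U1 <-] [V V1 <-].
have [W WV] := fset_lift (fun y (_ : y \in V) => f_surj y).
have [F gF /fsubsetP UF] := lfG ([fset i u | u in U] `|` W).
apply: le_ereal_sup_tmp; exists (entropy_at R phi F); first by exists F => //; exact: gF.1.
apply: entropy_at_add_le => //.
  by apply/fsubsetP => x xU; apply: UF; rewrite inE xU.
rewrite -WV; apply: subset_imfset => x xW.
by apply: UF; rewrite inE orbC; apply/orP; left.
Qed.

End ShortExactSequence.

(** * Hamiltonian groups *)

Section Hamiltonian.
Variable G : groupType.
Hypothesis hamG : hamiltonian G.

(** The cyclic subgroup generated by [a], possibly infinite; differences of
  natural numbers stand for integer exponents. *)
Definition powers (a : G) : {pred G} :=
  fun x => `[< exists m n : nat, x = a ^+ m / a ^+ n >].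

Lemma powersP a x : reflect (exists m n : nat, x = a ^+ m / a ^+ n) (x \in powers a).
Proof. exact: asboolP. Qed.

Lemma normal_of_group_closed (H : {pred G}) : group_closed H -> normal_subgroup H.
Proof.
move=> gH.
pose c1 := isMul1Closed.Build G H gH.1.
pose cM := isMulClosed.Build G H (group_closedM gH).
pose cV := isInvClosed.Build G H (group_closedV gH).
pose HG : groupClosed G := HB.pack H c1 cM cV.
exact: (hamG.2 HG).
Qed.

Lemma commuteXV (x y : G) m n : commute x y -> commute x (y ^+ m / y ^+ n).
Proof. by move=> xy; apply: commuteM; [|apply: commuteV]; exact: commuteX. Qed.

Lemma powers_closed a : group_closed (powers a).
Proof.
split; first by apply/powersP; exists 0%N, 0%N; rewrite mulgV.
move=> _ _ /powersP[m [n ->]] /powersP[p [q ->]]; apply/powersP.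
exists (m + q)%N, (p + n)%N.
rewrite !expgnDr !invgM invgK !mulgA; congr (_ / _).
rewrite -!mulgA; congr (_ * _).
by apply/esym/commuteV/commuteX/commute_sym/commuteX.
Qed.

Lemma commute_powers a x y : commute a x -> y \in powers x -> commute a y.
Proof. by move=> ax /powersP[m [n ->]]; exact: commuteXV. Qed.

Definition torsion (x : G) : Prop := exists2 n : nat, (0 < n)%N & x ^+ n = 1.

Lemma torsion_expg_eq x m n : m <> n -> x ^+ m = x ^+ n -> torsion x.
Proof.
wlog mn : m n / (m < n)%N => [th|_ xmn].
  by case: (ltngtP m n) => // h ne e; [apply: (th m n)|apply: (th n m) => // /esym].
exists (n - m)%N; first by rewrite subn_gt0.
by rewrite expgnFr ?(ltnW mn)// xmn mulgV.
Qed.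

(** The commutator [c] lies in <a> and in <b>, so it commutes with both.
  Conjugation by [b] fixes [c] and maps [a] to [a * c], hence
  [c = a ^+ m / a ^+ n] becomes [c = c * (c ^+ m / c ^+ n)].  So [c ^ (m - n)] is
  trivial, that is [a ^ ((m - n)^2)] is, and m <> n because [c] is not
  trivial. *)
Lemma noncommuting_torsion (a b : G) : ~ commute a b -> torsion a.
Proof.
move=> nab; pose c := [~ a, b].
have nP x : normal_subgroup (powers x) := normal_of_group_closed (powers_closed x).
have gP x : x \in powers x.
  by apply/powersP; exists 1%N, 0%N; rewrite expg0 invg1 mulg1.
have VP x y : y \in powers x -> y^-1 \in powers x.
  by move: y; exact: (group_closedV (powers_closed x)).
have MP x y z : y \in powers x -> z \in powers x -> y * z \in powers x.
  by move: y z; exact: (group_closedM (powers_closed x)).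
have ca : c \in powers a by rewrite /c commgEl MP ?VP ?nP.
have cb : c \in powers b by rewrite /c commgEr MP// nP// VP.
have comac : commute a c by exact: commute_powers ca.
have combc : commute b c by exact: commute_powers cb.
have abE : a ^ b = a * c by rewrite /c commgEl mulVKg.
have cbE : c ^ b = c by rewrite conjgE -combc mulKg.
have c1 : c <> 1 by move=> c1; apply: nab; apply/commgP/eqP.
clearbody c; have /powersP[m [n cE]] := ca.
have mn : m <> n.
  by move=> mn; apply: c1; rewrite cE mn mulgV.
have cmn : c ^+ m = c ^+ n.
  have h : c = (a * c) ^+ m / (a * c) ^+ n.
    by rewrite -abE -!conjXg -conjVg -conjMg -cE cbE.
  rewrite !expgMn// invgM mulgA -[X in X / _]mulgA in h.
  have com1 : commute (c ^+ m / c ^+ n) (a ^- n).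
    by apply/commuteV/commuteX/commute_sym/commuteXV.
  rewrite -mulgA com1 mulgA -cE in h.
  by apply/divg1_eq/(mulgI c); rewrite mulg1.
(* The two sides of (m - n)^2 = 0, expanded over the natural numbers. *)
apply: (@torsion_expg_eq a (m * m + n * n) (m * n + n * m)).
  move=> /eqP; apply/negP; rewrite neq_ltn; apply/orP; right.
  by move: mn => /eqP; rewrite neq_ltn => /orP[]; nia.
have cX k : c ^+ k = a ^+ (m * k) / a ^+ (n * k).
  rewrite cE expgnFl -?expgnA//.
  by apply/commuteX/commute_sym/commuteX.
move: cmn; rewrite !cX => e.
rewrite !expgnDr -(mulgVK (a ^+ (n * m)) (a ^+ (m * m))) e -!mulgA; congr (_ * _).
rewrite (_ : a ^+ (n * m) * a ^+ (n * n) = a ^+ (n * n) * a ^+ (n * m)) ?mulKg//.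
exact/commuteX/commute_sym/commuteX.
Qed.

(** If [x] commutes with two elements [a] and [b] that do not commute, then
  neither [a] nor [a * x] commutes with [b], so both are torsion; and [x] commutes
  with [a]. *)
Lemma hamiltonian_torsion (x : G) : torsion x.
Proof.
have [a [b nab]] : exists a b : G, ~ commute a b.
  apply: contrapT => h; apply: hamG.1 => a b; apply: contrapT => nab.
  by apply: h; exists a, b.
case: (pselect (commute x b)) => [xb|/noncommuting_torsion//].
case: (pselect (commute x a)) => [xa|/noncommuting_torsion//].
have [m m0 am] := noncommuting_torsion nab.
have [n n0 axn] : torsion (a * x).
  apply: (@noncommuting_torsion _ b) => h; apply: nab.
  rewrite -[a](mulgK x); apply/commute_sym/commuteM; first exact: commute_sym.
  by apply/commuteV/commute_sym.
exists (m * n)%N; first by rewrite muln_gt0 m0.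
have : (a * x) ^+ (m * n) = 1 by rewrite mulnC expgnA axn expg1n.
by rewrite expgMn ?expgnA ?am ?expg1n ?mul1g//; exact: commute_sym.
Qed.

Lemma hamiltonian_finsubgroups_normal : finsubgroups_normal G.
Proof.
move=> F gF x g xF; apply: (normal_of_group_closed (H := mem F)) => //.
Qed.

Lemma finsubgroup_cycle (x : G) : exists2 C : {fset G}, finsubgroup C & x \in C.
Proof.
have [n n0 xn] := hamiltonian_torsion x.
have xmod k : x ^+ k = x ^+ (k %% n).
  by rewrite {1}(divn_eq k n) expgnDr mulnC expgnA xn expg1n mul1g.
pose C := [fset x ^+ k | k in iota 0 n].
have CX k : x ^+ k \in C.
  apply/imfsetP; exists (k %% n)%N; last exact: xmod.
  by rewrite /= mem_iota ltn_mod.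
exists C; last by rewrite -[x]expg1 CX.
split=> [|_ _ /imfsetP[k /= _ ->] /imfsetP[l /= + ->]]; first exact: (CX 0%N).
rewrite mem_iota => /andP[_ ln].
suff -> : x ^- l = x ^+ (n - l) by rewrite -expgnDr.
by rewrite expgnFr ?(ltnW ln)// xn mul1g.
Qed.

(** The subgroup is the product of the cyclic groups generated by the elements of
  [U], finite by torsion and normal by hypothesis. *)
Lemma hamiltonian_locally_finite : locally_finite G.
Proof.
elim/fset1U_rect=> [|x X _ [F gF /fsubsetP XF]].
  by exists [fset 1]; [exact: finsubgroup_triv|exact: fsub0set].
have [C gC xC] := finsubgroup_cycle x.
exists (fset_mul F C).
  by apply: finsubgroup_mul => //; exact: hamiltonian_finsubgroups_normal.
apply/fsubsetP => y; rewrite !inE => /orP[/eqP->|/XF yF].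
  by rewrite -[x]mul1g mem_fset_mul// finsubgroup1.
by rewrite -[y]mulg1 mem_fset_mul// finsubgroup1.
Qed.

End Hamiltonian.

Theorem corollary5p10 (R : realType) (G : groupType) (hamG : hamiltonian G)
    (phi : {multiplicative G -> G}) (H : groupClosed G)
    (phiH : forall x : G, x \in H -> phi x \in H) :
  (alg_entropy R phi =
   alg_entropy R (restr_endo phiH) +
   alg_entropy R (quot_endo (hamiltonian_normal hamG H) phiH))%E.
Proof.
pose Q := quotient_of (hamiltonian_normal hamG H).
apply: (@alg_entropy_exact R (subgroup_of H) G Q (restr_endo phiH) phi
  (quot_endo (hamiltonian_normal hamG H) phiH) (val : subgroup_of H -> G) (\pi_Q)).
- exact: val_inj.
- by move=> q; exists (repr q); exact: reprK.
- move=> x; have -> : (\pi_Q x = 1) <-> x \in H.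
    rewrite (_ : 1 = \pi_Q 1); last by rewrite morph1.
    split=> [/esym/quot_eqP|xH]; first by rewrite invg1 mul1g.
    by apply/esym/quot_eqP; rewrite invg1 mul1g.
  split=> [xH|[u <-]]; last exact: valP.
  by exists (exist _ x xH).
- by [].
- by move=> x; exact: quot_endoE.
- exact: hamiltonian_locally_finite.
- exact: hamiltonian_finsubgroups_normal.
Qed.
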